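(* Let $H$ be a finite-dimensional Hopf algebra over a field $\Bbbk$ with antipode $S$. If $H$ admits a pivotal element $g$, then $$\gamma(V)=\nu_2(V)\cdot\operatorname{qdim}_\ell(V)=\nu_2(V)\cdot\operatorname{qdim}_r(V)$$ for all absolutely simple finite-dimensional $H$-modules $V$, where $\nu_2(V)$, $\operatorname{qdim}_\ell(V)$ and $\operatorname{qdim}_r(V)$ are computed using the pivotal element $g$. In particular, $\nu_2(V)\operatorname{qdim}_\ell(V)$ is independent of the choice of the pivotal element $g$.
   Context: For a finite-dimensional left $H$-module $V$, $V^\vee$ denotes its left dual, i.e. $V^*$ with action $(hf)(v)=f(S(h)v)$. If $V\cong V^\vee$ as $H$-modules (self-dual), then $S(\operatorname{ann}V)=\operatorname{ann}V$, so $S$ induces an algebra anti-automorphism $S_V$ of $H/\operatorname{ann}V$, $S_V(h+\operatorname{ann}V)=S(h)+\operatorname{ann}V$. A module is absolutely simple if it is simple and remains simple after every extension of the base field. For absolutely simple $V$, $\gamma(V)=\operatorname{Tr}(S_V)$ if $V\cong V^\vee$ and $\gamma(V)=0$ otherwise. A pivotal element of $H$ is a group-like element $g\in H$ such that $S^2(h)=ghg^{-1}$ for all $h\in H$. Given a pivotal element $g$ and a finite-dimensional $H$-module $V$ with character $\chi_V$, the left and right pivotal (quantum) dimensions are $\operatorname{qdim}_\ell(V)=\chi_V(g^{-1})$ and $\operatorname{qdim}_r(V)=\chi_V(g)$. The second Frobenius-Schur indicator of $V$ is $\nu_2(V)=\operatorname{Tr}(E_2)\in\Bbbk$, where $E_2$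 is the linear operator on the space of invariants $(V\otimes V)^H=\{w\in V\otimes V: \Delta(h)w=\varepsilon(h)w\ \forall h\in H\}$ given by $E_2(\sum_i u_i\otimes v_i)=\sum_i v_i\otimes g^{-1}u_i$. *)

(* Defs.v *)
From HB Require Import structures.
From mathcomp Require Import all_boot all_order all_algebra all_field.
From mathcomp Require Import boolp.

Set Implicit Arguments.
Unset Strict Implicit.
Unset Printing Implicit Defensive.

Import GRing.Theory.
Local Open Scope ring_scope.

Section LinearAlgebra.
Variable k : fieldType.

Definition lftrace (V : vectType k) (f : 'End(V)) : k :=
  \tr (passmx.mxof (vbasis {:V}) (vbasis {:V}) f).

Lemma lftrace_basis (V : vectType k) (e : (\dim {:V}).-tuple V) (f : 'End(V)) :
  basis_of fullv e -> lftrace f = \tr (passmx.mxof e e f).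
Proof.
move=> eB; have bB := vbasisP {:V}; set b := vbasis {:V} in bB *.
have fE : f = ((\1 \o f) \o \1)%VF by rewrite comp_lfun1r comp_lfun1l.
rewrite /lftrace {1}fE (passmx.mxof_comp b b eB) (passmx.mxof_comp e b eB).
rewrite mulmxA mxtrace_mulC mulmxA -(passmx.mxof_comp e e bB).
by rewrite comp_lfun1l passmx.mxof1 ?(basis_free eB) // mul1mx.
Qed.

(* The restriction to U of an endomorphism f preserving U; restr_lfunE is the
   check.  (vsproj U extends the identity of U to a projection onto U.) *)
Definition restr_lfun (V : vectType k) (U : {vspace V}) (f : 'End(V)) :
  'End(subvs_of U) := linfun (vsproj U \o f \o vsval).

Lemma restr_lfunE (V : vectType k) (U : {vspace V}) (f : 'End(V)) :
  (f @: U <= U)%VS -> forall u, vsval (restr_lfun U f u) = f (vsval u).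
Proof.
move=> fU u; rewrite lfunE /= vsprojK //.
by apply: (subvP fU); apply: memv_img; apply: subvsP.
Qed.

(* The quotient V / U, realised on a complement of U: quot_proj U is a
   surjection with kernel U (quot_proj_ker, quot_proj_surj), and quot_lfun U f
   is the endomorphism induced by f when f preserves U (quot_lfunE). *)
Definition quotv (V : vectType k) (U : {vspace V}) : vectType k :=
  subvs_of (U^C)%VS.

Definition quot_proj (V : vectType k) (U : {vspace V}) : 'Hom(V, quotv U) :=
  linfun (vsproj (U^C)%VS \o daddv_pi (U^C)%VS U).

Definition quot_lfun (V : vectType k) (U : {vspace V}) (f : 'End(V)) :
  'End(quotv U) := linfun (quot_proj U \o f \o vsval).

Lemma quot_projK (V : vectType k) (U : {vspace V}) :
  cancel (@vsval _ _ (U^C)%VS) (quot_proj U).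
Proof.
move=> u; rewrite lfunE /= daddv_pi_id ?subvsP ?vsvalK //.
by rewrite capvC capv_compl.
Qed.

Lemma quot_proj_surj (V : vectType k) (U : {vspace V}) :
  limg (quot_proj U) = fullv.
Proof.
apply/eqP; rewrite eqEsubv subvf; apply/subvP => u _.
by rewrite -[u]quot_projK memv_img ?memvf.
Qed.

Lemma quot_proj_ker (V : vectType k) (U : {vspace V}) :
  lker (quot_proj U) = U.
Proof.
have dUC : (U^C :&: U = 0)%VS by rewrite capvC capv_compl.
have dCU : (U :&: U^C = 0)%VS by rewrite capv_compl.
have piE v : vsval (quot_proj U v) = daddv_pi (U^C)%VS U v.
  by rewrite lfunE /= vsprojK ?memv_pi.
apply/vspaceP => v; rewrite memv_ker -(inj_eq val_inj) /= piE.
have vE : daddv_pi (U^C)%VS U v + daddv_pi U (U^C)%VS v = v.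
  by rewrite daddv_pi_add // addvC addv_complf memvf.
apply/eqP/idP => [v0|Uv].
  by rewrite -vE v0 add0r memv_pi.
by move: vE; rewrite (daddv_pi_id dCU Uv) => /(canRL (addrK _)); rewrite subrr.
Qed.

Lemma quot_lfunE (V : vectType k) (U : {vspace V}) (f : 'End(V)) :
  (f @: U <= U)%VS ->
  forall v, quot_lfun U f (quot_proj U v) = quot_proj U (f v).
Proof.
move=> fU v; rewrite [LHS]lfunE /=; apply/eqP; rewrite -subr_eq0 -!linearB /=.
rewrite -memv_ker quot_proj_ker; apply: (subvP fU); apply: memv_img.
have : vsval (quot_proj U v) - v \in lker (quot_proj U).
  by rewrite memv_ker linearB /= quot_projK subrr.
by rewrite quot_proj_ker.
Qed.

(* The tensor product U (x) V in coordinates: the matrix t stands for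
   \sum_(i, j) t i j *: (e_i (x) e'_j), with e = vbasis {:U} and
   e' = vbasis {:V}.  The universal property is tlift_tprod, tensor_ext. *)
Definition tensor (U V : vectType k) : vectType k :=
  'M[k]_(\dim {:U}, \dim {:V}).

Definition tprod (U V : vectType k) (u : U) (v : V) : tensor U V :=
  \matrix_(i, j) (coord (vbasis {:U}) i u * coord (vbasis {:V}) j v).

Definition tlift_fun (U V W : vectType k) (b : U -> V -> W)
    (t : tensor U V) : W :=
  \sum_i \sum_j t i j *: b (vbasis {:U})`_i (vbasis {:V})`_j.

(* The linear map U (x) V -> W with u (x) v |-> b u v, for b bilinear. *)
Definition tlift (U V W : vectType k) (b : U -> V -> W) :
  'Hom(tensor U V, W) := linfun (tlift_fun b).

Fact tlift_is_linear (U V W : vectType k) (b : U -> V -> W) :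
  linear (tlift_fun b).
Proof.
move=> a s t; rewrite /tlift_fun scaler_sumr -big_split /=.
apply: eq_bigr => i _; rewrite scaler_sumr -big_split /=.
by apply: eq_bigr => j _; rewrite !mxE scalerDl scalerA.
Qed.
HB.instance Definition _ (U V W : vectType k) (b : U -> V -> W) :=
  GRing.isLinear.Build k (tensor U V) W _ (tlift_fun b) (tlift_is_linear b).

Lemma tlift_tprod (U V W : vectType k) (b : U -> V -> W) :
  (forall v, linear (b^~ v)) -> (forall u, linear (b u)) ->
  forall u v, tlift b (tprod u v) = b u v.
Proof.
move=> bl br u v; rewrite lfunE /= /tlift_fun.
pose bl' v := GRing.isLinear.Build k U W _ (b^~ v) (bl v).
pose br' u := GRing.isLinear.Build k V W _ (b u) (br u).
pose Bl v : {linear U -> W} := HB.pack (b^~ v) (bl' v).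
pose Br u : {linear V -> W} := HB.pack (b u) (br' u).
rewrite -[RHS]/(Bl v u) {2}(coord_vbasis (memvf u)) linear_sum.
apply: eq_bigr => i _; rewrite linearZ -[Bl v _]/(Br (vbasis {:U})`_i v).
rewrite {2}(coord_vbasis (memvf v)) linear_sum /= scaler_sumr.
apply: eq_bigr => j _; rewrite -[b _ (_ *: _)]/(Br _ (_ *: _)) linearZ mxE /=.
by rewrite scalerA.
Qed.

Lemma tensor_ext (U V W : vectType k) (f g : 'Hom(tensor U V, W)) :
  (forall u v, f (tprod u v) = g (tprod u v)) -> f = g.
Proof.
move=> fg; apply/lfunP => t; rewrite (matrix_sum_delta t) !linear_sum /=.
apply: eq_bigr => i _; rewrite !linear_sum /=; apply: eq_bigr => j _.
rewrite !linearZ /=; congr (_ *: _).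
suff -> : delta_mx i j = tprod (vbasis {:U})`_i (vbasis {:V})`_j by apply: fg.
apply/matrixP => a b; rewrite !mxE !coord_free ?(basis_free (vbasisP _)) //.
by case: (i =P a) => [->|/eqP/negPf ia]; case: (j =P b) => [->|/eqP/negPf jb];
  rewrite ?eqxx 1?eq_sym ?ia ?jb ?mulr1 ?mulr0 ?mul0r // eq_sym ?ia ?jb ?mulr0.
Qed.

Definition tmap (U U' V V' : vectType k) (f : 'Hom(U, U')) (g : 'Hom(V, V')) :
  'Hom(tensor U V, tensor U' V') := tlift (fun u v => tprod (f u) (g v)).

Definition tassoc (U V W : vectType k) :
  'Hom(tensor (tensor U V) W, tensor U (tensor V W)) :=
  tlift (fun t w => tlift (fun u v => tprod u (tprod v w)) t).

Definition tmull (A : falgType k) : 'Hom(tensor A A, A) :=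
  tlift (fun a b : A => a * b).

(* The product (a (x) b)(c (x) d) = ac (x) bd of A (x) A. *)
Definition tensor_mul (A : falgType k) (s t : tensor A A) : tensor A A :=
  tlift (fun a b : A => tmap (amull a) (amull b) t) s.

End LinearAlgebra.

HB.mixin Record isHopf (k : fieldType) H of Falgebra k H := {
  comul : 'Hom(H, tensor H H);
  counit : 'Hom(H, k^o);
  antipode : 'End(H);
  comul1 : comul 1 = tprod 1 1;
  comulM : forall a b : H, comul (a * b) = tensor_mul (comul a) (comul b);
  counit1 : counit 1 = 1;
  counitM : forall a b : H, counit (a * b) = counit a * counit b;
  comulA : forall h : H, tassoc H H H (tmap comul \1 (comul h))
                         = tmap \1 comul (comul h);
  counitl : forall h : H, tlift (fun a b : H => counit a *: b) (comul h) = h;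
  counitr : forall h : H, tlift (fun a b : H => counit b *: a) (comul h) = h;
  antipodel : forall h : H,
    tmull H (tmap antipode \1 (comul h)) = counit h *: 1;
  antipoder : forall h : H,
    tmull H (tmap \1 antipode (comul h)) = counit h *: 1
}.

#[short(type="hopfType")]
HB.structure Definition Hopf (k : fieldType) :=
  { H of Falgebra k H & isHopf k H }.

Section Modules.
Variables (k : fieldType) (H : hopfType k).

(* A finite-dimensional left H-module is a vector space V together with an
   action rho : H -> End(V) satisfying is_hmod; \o is the usual composition. *)
Definition is_hmod (V : vectType k) (rho : 'Hom(H, 'End(V))) : Prop :=
  rho 1 = \1%VF /\ forall a b, rho (a * b) = (rho a \o rho b)%VF.

Definition hmod_iso (V W : vectType k)
    (rho : 'Hom(H, 'End(V))) (sigma : 'Hom(H, 'End(W))) : Prop :=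
  exists2 T : 'Hom(V, W), bijective T &
    forall h v, T (rho h v) = sigma h (T v).

Definition dual_fun (V : vectType k) (rho : 'Hom(H, 'End(V))) (h : H)
    (f : 'Hom(V, k^o)) : 'Hom(V, k^o) := (f \o rho (antipode h))%VF.

Definition dual_act (V : vectType k) (rho : 'Hom(H, 'End(V))) :
    'Hom(H, 'End('Hom(V, k^o))) :=
  linfun (fun h => linfun (dual_fun rho h)).

Lemma dual_actE (V : vectType k) (rho : 'Hom(H, 'End(V))) h f v :
  dual_act rho h f v = f (rho (antipode h) v).
Proof.
have lin2 h' : linear (dual_fun rho h').
  by move=> a x y; rewrite /dual_fun comp_lfunDl comp_lfunZl.
pose L2 h' : {linear 'Hom(V, k^o) -> 'Hom(V, k^o)} :=
  HB.pack (dual_fun rho h') (GRing.isLinear.Build k _ _ _ _ (lin2 h')).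
have E2 h' x : linfun (dual_fun rho h') x = dual_fun rho h' x.
  exact: (lfunE (L2 h')).
have lin1 : linear (fun h' => linfun (dual_fun rho h')).
  move=> a x y; apply/lfunP => z; rewrite add_lfunE scale_lfunE !E2.
  by rewrite /dual_fun !linearP /= comp_lfunDr comp_lfunZr.
pose L1 : {linear H -> 'End('Hom(V, k^o))} :=
  HB.pack (fun h' => linfun (dual_fun rho h'))
    (GRing.isLinear.Build k _ _ _ _ lin1).
by rewrite /dual_act (lfunE L1) /= E2 lfunE.
Qed.

Definition self_dual (V : vectType k) (rho : 'Hom(H, 'End(V))) : Prop :=
  hmod_iso rho (dual_act rho).

(* For self-dual V the antipode preserves the annihilator lker rho of V, so that
   it induces an endomorphism of H / ann V. *)
Lemma antipode_ann (V : vectType k) (rho : 'Hom(H, 'End(V))) :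
  self_dual rho -> (antipode @: lker rho <= lker rho)%VS.
Proof.
case=> T [T' _ TK] TE; apply/subvP => _ /memv_imgP[h + ->].
rewrite !memv_ker => /eqP h0; apply/eqP/lfunP => v; rewrite zero_lfunE.
rewrite (coord_vbasis (memvf (rho (antipode h) v))) big1 // => i _.
have -> : coord (vbasis {:V}) i (rho (antipode h) v) = 0; last exact: scale0r.
have cl : linear (coord (vbasis {:V}) i : V -> k^o).
  by move=> c x y; rewrite linearP.
pose c : {linear V -> k^o} :=
  HB.pack (coord (vbasis {:V}) i : V -> k^o) (GRing.isLinear.Build k _ _ _ _ cl).
pose f : 'Hom(V, k^o) := linfun c.
have <- : f (rho (antipode h) v) = coord (vbasis {:V}) i (rho (antipode h) v).
  by rewrite lfunE.
by rewrite -dual_actE -[f]TK -TE h0 zero_lfunE linear0 zero_lfunE.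
Qed.

Definition hmod_char (V : vectType k) (rho : 'Hom(H, 'End(V))) (h : H) : k :=
  lftrace (rho h).

(* Tr(S_V) on H / ann V if V is self-dual, and 0 otherwise. *)
Definition gamma (V : vectType k) (rho : 'Hom(H, 'End(V))) : k :=
  if `[< self_dual rho >] then lftrace (quot_lfun (lker rho) antipode) else 0.

Definition simple_act (K : fieldType) (W : vectType K) (A : Type)
    (act : A -> W -> W) : Prop :=
  (0 < \dim {:W})%N /\
  forall U : {vspace W}, (forall a u, u \in U -> act a u \in U) ->
    U = 0%VS \/ U = fullv.

Section BaseChange.
Variables (K : fieldType) (phi : {rmorphism k -> K}).

(* The scalar extension V (x) K along phi, in coordinates on vbasis {:V}. *)
Definition ext_space (V : vectType k) : vectType K := 'rV[K]_(\dim {:V}).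

Definition ext_vec (V : vectType k) (v : V) : ext_space V :=
  \row_j phi (coord (vbasis {:V}) j v).

(* (h (x) a) (v (x) b) = h v (x) ab *)
Definition ext_act (V : vectType k) (rho : 'Hom(H, 'End(V)))
    (x : ext_space H) (w : ext_space V) : ext_space V :=
  \sum_i \sum_j (x 0 i * w 0 j) *:
    ext_vec (rho (vbasis {:H})`_i (vbasis {:V})`_j).

Lemma ext_actE (V : vectType k) (rho : 'Hom(H, 'End(V))) a b h v :
  ext_act rho (a *: ext_vec h) (b *: ext_vec v) = (a * b) *: ext_vec (rho h v).
Proof.
have Dv (x y : V) : ext_vec (x + y) = ext_vec x + ext_vec y.
  by apply/rowP => j; rewrite !mxE linearD rmorphD.
have Zv c (x : V) : ext_vec (c *: x) = phi c *: ext_vec x.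
  by apply/rowP => j; rewrite !mxE linearZ rmorphM.
have V0 : ext_vec (0 : V) = 0 by apply/rowP => j; rewrite !mxE linear0 rmorph0.
have Sv n (F : 'I_n -> V) : ext_vec (\sum_i F i) = \sum_i ext_vec (F i).
  exact: (big_morph (@ext_vec V) Dv V0).
rewrite {2}(coord_vbasis (memvf h)) linear_sum sum_lfunE Sv scaler_sumr.
apply: eq_bigr => i _; rewrite {2}(coord_vbasis (memvf v)) linear_sum Sv.
rewrite scaler_sumr; apply: eq_bigr => j _.
rewrite !linearZ /= scale_lfunE !Zv !scalerA !mxE; congr (_ *: _).
by rewrite -!mulrA; congr (_ * _); rewrite mulrCA; congr (_ * _); rewrite mulrC.
Qed.

End BaseChange.

Definition abs_simple (V : vectType k) (rho : 'Hom(H, 'End(V))) : Prop :=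
  simple_act (fun h v => rho h v) /\
  forall (K : fieldType) (phi : {rmorphism k -> K}),
    simple_act (ext_act phi rho).

Definition grouplike (g : H) : Prop := comul g = tprod g g /\ counit g = 1.

(* A group-like element is a unit of H, so that g^-1 is its true inverse. *)
Lemma grouplike_unit g : grouplike g -> g \is a GRing.unit.
Proof.
have tmullE (a b : H) : tmull H (tprod a b) = a * b.
  apply: tlift_tprod => [v c x y|u c x y]; first by rewrite mulrDl scalerAl.
  by rewrite mulrDr scalerAr.
have tlD (U V : vectType k) (v : V) : linear (fun u : U => tprod u v).
  by move=> c x y; apply/matrixP => i j; rewrite !mxE linearP mulrDl mulrA.
have tlR (U V : vectType k) (u : U) : linear (fun v : V => tprod u v).
  by move=> c x y; apply/matrixP => i j; rewrite !mxE linearP mulrDr mulrCA.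
have tmapE (f f' : 'End(H)) (a b : H) :
    tmap f f' (tprod a b) = tprod (f a) (f' b).
  apply: tlift_tprod => [v c x y|u c x y]; rewrite linearP.
    exact: (tlD _ _ (f' v) c).
  exact: (tlR _ _ (f u) c).
case=> Dg eg; apply/unitrP; exists (antipode g); split.
  by have := antipodel g; rewrite Dg tmapE tmullE eg id_lfunE scale1r.
by have := antipoder g; rewrite Dg tmapE tmullE eg id_lfunE scale1r.
Qed.

Definition pivotal (g : H) : Prop :=
  grouplike g /\ forall h, antipode (antipode h) = g * h * g^-1.

Definition qdiml (g : H) (V : vectType k) (rho : 'Hom(H, 'End(V))) : k :=
  hmod_char rho g^-1.

Definition qdimr (g : H) (V : vectType k) (rho : 'Hom(H, 'End(V))) : k :=
  hmod_char rho g.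

(* The action of t in H (x) H on V (x) V. *)
Definition tensor_act (V : vectType k) (rho : 'Hom(H, 'End(V)))
    (t : tensor H H) : 'End(tensor V V) :=
  tlift (fun a b : H => tmap (rho a) (rho b)) t.

Definition inv_fun (V : vectType k) (rho : 'Hom(H, 'End(V))) (h : H) :
    'End(tensor V V) :=
  tensor_act rho (comul h) - (counit h : k) *: \1%VF.

(* (V (x) V)^H; h may be restricted to a basis of H since inv_fun is linear in
   h, and inv_spaceP gives the condition for all h. *)
Definition inv_space (V : vectType k) (rho : 'Hom(H, 'End(V))) :
    {vspace tensor V V} :=
  (\bigcap_(i < \dim {:H}) lker (inv_fun rho (vbasis {:H})`_i))%VS.

Lemma inv_spaceP (V : vectType k) (rho : 'Hom(H, 'End(V))) (w : tensor V V) :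
  w \in inv_space rho <->
  forall h, tensor_act rho (comul h) w = (counit h : k) *: w.
Proof.
have E h : (w \in lker (inv_fun rho h))
    = (tensor_act rho (comul h) w == (counit h : k) *: w).
  by rewrite memv_ker /inv_fun add_lfunE opp_lfunE scale_lfunE id_lfunE subr_eq0.
rewrite memvE; split=> [/subv_bigcapP wi h|wh]; last first.
  by apply/subv_bigcapP => i _; rewrite -memvE E wh.
rewrite {1 2}(coord_vbasis (memvf h)) /tensor_act !linear_sum sum_lfunE scaler_suml.
apply: eq_bigr => i _; have := wi i isT; rewrite -memvE E => /eqP wE.
by rewrite !linearZ scale_lfunE /= -[in RHS]scalerA -wE.
Qed.

(* u (x) v |-> v (x) g^-1 u, which preserves inv_space rho when g is pivotal. *)
Definition E2 (g : H) (V : vectType k) (rho : 'Hom(H, 'End(V))) :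
    'End(tensor V V) :=
  tlift (fun u v : V => tprod v (rho g^-1 u)).

Definition nu2 (g : H) (V : vectType k) (rho : 'Hom(H, 'End(V))) : k :=
  lftrace (restr_lfun (inv_space rho) (E2 g rho)).

End Modules.

(* Main.v *)
(** Over the coordinates of a basis of V, an element of V (x) V is a matrix w, and
    with A h the matrix of h acting on row vectors, w is H-invariant iff
    (A (S h))^T w = w (A h) for all h.  As V is absolutely simple, Schur's lemma
    makes every nonzero invariant w invertible and unique up to a scalar, and such
    a w amounts to an isomorphism of V with its dual.  By density h |-> A h is onto
    the full matrix algebra, on which S_V becomes B |-> (w B w^-1)^T, whose trace is
    tr (w^T w^-1).  On the other hand E_2 w = w^T A(g^-1) = nu_2(V) w, so that
    w^T = nu_2(V) w A(g) and tr (w^T w^-1) = nu_2(V) chi_V(g).  Invariance of w at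
    h = g gives chi_V(g^-1) = chi_V(g). *)
From HB Require Import structures.
Require Import Defs.
From mathcomp Require Import all_boot all_order all_algebra all_field.
From mathcomp Require Import boolp.

Set Implicit Arguments.
Unset Strict Implicit.
Unset Printing Implicit Defensive.

Import GRing.Theory passmx.
Local Open Scope ring_scope.

(** Induction on the degree: an irreducible [p] has a root in k[X]/(p), and otherwise a proper
    nonconstant divisor of [p] has one in some extension. This supplies the eigenvalue needed for
    Schur's lemma over an arbitrary field. *)
Lemma exists_root_ext (k : fieldType) (p : {poly k}) : (1 < size p)%N ->
  exists (K : fieldType) (phi : {rmorphism k -> K}) (z : K),
    root (map_poly phi p) z.
Proof.
have [n] := ubnP (size p); elim: n p => // n IHn p /ltnSE le_p_n p_gt1.
have [irr_p | /not_andP[//|red_p]] := EM (irreducible_poly p).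
  have [L _ [z pz0 _]] := irredp_FAdjoin irr_p.
  by exists L, (in_alg L), z.
have /existsNP[q /not_implyP[q_neq1 /not_implyP[q_dv_p /negP q_neqp]]] := red_p.
have p_neq0 : p != 0 by rewrite -size_poly_gt0 ltnW.
have q_neq0 : q != 0 by apply: contraTneq q_dv_p => ->; rewrite dvd0p.
have lt_q_p : (size q < size p)%N.
  by rewrite ltn_neqAle dvdp_leq // andbT dvdp_size_eqp.
have q_gt1 : (1 < size q)%N by rewrite ltn_neqAle eq_sym q_neq1 size_poly_gt0.
have [K [phi [z qz0]]] := IHn q (leq_trans lt_q_p le_p_n) q_gt1.
exists K, phi, z; move: qz0; rewrite !root_factor_theorem => qz0.
by apply: dvdp_trans qz0 _; rewrite dvdp_map.
Qed.

(** * Schur's lemma and density for absolutely simple modules *)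

Section Density.
Variables (k : fieldType) (H : hopfType k) (V : vectType k).
Variables (rho : 'Hom(H, 'End(V))).
Let e := vbasis {:V}.
Let eB : basis_of fullv e := vbasisP {:V}.

Lemma ext_act_mx (K : fieldType) (phi : {rmorphism k -> K})
    (x : ext_space K H) (w : ext_space K V) :
  ext_act phi rho x w =
  w *m \sum_i x 0 i *: map_mx phi (mxof e e (rho (vbasis {:H})`_i)).
Proof.
rewrite mulmx_sumr; apply: eq_bigr => i _.
rewrite -scalemxAr mulmx_sum_row scaler_sumr; apply: eq_bigr => j _.
rewrite scalerA; congr (_ *: _); apply/rowP => l.
by rewrite !mxE vecof_delta.
Qed.

(** Schur's lemma: over some extension [K] the matrix of [T] has an eigenvalue [z], whose eigenspace
    is a nonzero submodule of the extended module, hence all of it. So the matrix is scalar over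
    [K], and therefore already over [k]. *)
Lemma abs_simple_End (T : 'End(V)) : abs_simple rho ->
  (forall h, (T \o rho h = rho h \o T)%VF) -> exists c, T = c *: \1%VF.
Proof.
move=> [[d_gt0 _] simpleK] Tcomm; pose B := mxof e e T.
have Bcomm h : B *m mxof e e (rho h) = mxof e e (rho h) *m B.
  by rewrite -!(mxof_comp e e eB) Tcomm.
have [|K [phi [z]]] := @exists_root_ext _ (char_poly B).
  by rewrite size_char_poly ltnS.
rewrite map_char_poly -eigenvalue_root_char => /eigenvalueP[w wE w_neq0].
(* The subspace to which simplicity over [K] is applied is the [z]-eigenspace, written as a
   kernel. *)
have [_ /(_ (lker (linfun (mulmxr (map_mx phi B - z%:M)))))] := simpleK K phi.
have memU (u : ext_space K V) :
    (u \in lker (linfun (mulmxr (map_mx phi B - z%:M))))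
      = (u *m map_mx phi B == z *: u).
  by rewrite memv_ker lfunE /= mulmxBr mul_mx_scalar subr_eq0.
case=> [x u|U0|UT].
- rewrite !memU => /eqP uE; rewrite ext_act_mx; set N := \sum_i _.
  have NB : N *m map_mx phi B = map_mx phi B *m N.
    rewrite mulmx_sumr mulmx_suml; apply: eq_bigr => i _.
    by rewrite -scalemxAr -scalemxAl -!map_mxM Bcomm.
  by rewrite -mulmxA NB mulmxA uE scalemxAl.
- have: (w : ext_space K V) \in (0%VS : {vspace ext_space K V}).
    by rewrite -U0 memU wE.
  by rewrite memv0 (negPf w_neq0).
have phiB i j : phi (B i j) = z *+ (i == j).
  have := memvf (delta_mx 0 i : ext_space K V); rewrite -UT memU -rowE.
  by move/eqP/rowP/(_ j); rewrite !mxE eqxx /= [j == i]eq_sym mulr_natr.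
(* The eigenvalue descends to [k]: it is the image under [phi] of the first diagonal entry, which
   exists as V is nonzero. *)
have := phiB (Ordinal d_gt0) (Ordinal d_gt0); rewrite eqxx.
move: (B _ _) => c phic; exists c.
apply: (can_inj (mxofK eB eB)); rewrite linearZ /= mxof1 ?(basis_free eB) //.
apply/matrixP => i j; apply: (fmorph_inj phi); rewrite phiB !mxE rmorphM phic.
by rewrite rmorph_nat mulr_natr.
Qed.

Definition orbit_map (v : V) : 'Hom(H, V) := linfun (fun h => rho h v).

Lemma orbit_mapE v h : orbit_map v h = rho h v.
Proof.
have lin : linear (fun h => rho h v).
  by move=> a x y; rewrite linearP add_lfunE scale_lfunE.
pose L : {linear H -> V} := HB.pack (fun h => rho h v)
  (GRing.isLinear.Build k _ _ _ _ lin).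
exact: (lfunE L).
Qed.

Definition annv (s : seq V) : {vspace H} :=
  (\bigcap_(i < size s) lker (orbit_map s`_i))%VS.

Lemma annvP s h : reflect (forall v, v \in s -> rho h v = 0) (h \in annv s).
Proof.
rewrite memvE; apply: (iffP subv_bigcapP) => [sh v vs | sh i _].
  rewrite -(nth_index 0 vs) -orbit_mapE; apply/eqP; rewrite -memv_ker memvE.
  by have := vs; rewrite -index_mem => lt_vs; apply: (sh (Ordinal lt_vs)).
by rewrite -memvE memv_ker orbit_mapE sh ?mem_nth.
Qed.

Hypotheses (Vmod : is_hmod rho) (Vsimple : abs_simple rho).

(** [annv s] is a left ideal of [H], so its image under h |-> hv is a submodule of V. *)
Lemma orbit_annv s v : (orbit_map v @: annv s)%VS = 0%VS
  \/ (orbit_map v @: annv s)%VS = fullv.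
Proof.
apply: Vsimple.1.2 => a _ /memv_imgP[h hs ->].
rewrite orbit_mapE -comp_lfunE -Vmod.2 -orbit_mapE memv_img //.
apply/annvP => u us; rewrite Vmod.2 comp_lfunE (annvP _ _ hs _ us).
by rewrite linear0.
Qed.

(* The Jacobson density theorem. *)
Lemma annv_span s v : (orbit_map v @: annv s)%VS = 0%VS -> v \in <<s>>%VS.
Proof.
elim: s v => [|u s IHs] v.
  move=> v0; have: orbit_map v 1 \in (0%VS : {vspace V}).
    by rewrite -v0 memv_img //; apply/annvP.
  by rewrite orbit_mapE Vmod.1 id_lfunE span_nil.
(* This makes the map hu |-> hv, for h in [annv s], well defined. *)
move=> v0; have rho0 h : h \in annv s -> rho h u = 0 -> rho h v = 0.
  move=> hs hu; apply/eqP; rewrite -memv0 -v0 -orbit_mapE memv_img //.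
  by apply/annvP => w; rewrite inE => /predU1P[-> // | ws]; apply: (annvP _ _ hs).
have [u0 | uT] := orbit_annv s u.
  rewrite span_cons (subvP (addvSr _ _)) // IHs //.
  apply/eqP; rewrite -subv0; apply/subvP => _ /memv_imgP[h hs ->].
  rewrite memv0 orbit_mapE rho0 //; apply/eqP; rewrite -memv0 -u0 -orbit_mapE.
  exact: memv_img.
pose f : 'Hom(subvs_of (annv s), V) := (orbit_map u \o linfun vsval)%VF.
(* When [annv s] moves u onto all of V, the map hu |-> hv is an endomorphism of V, built by choosing
   preimages under [f]; it will commute with [H] and so be a scalar c. *)
pose T : 'End(V) := (orbit_map v \o linfun vsval \o f^-1)%VF.
have fE h : f h = rho (vsval h) u by rewrite comp_lfunE lfunE orbit_mapE.
have limgf x : x \in limg f.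
  have /memv_imgP[h hs ->] : x \in (orbit_map u @: annv s)%VS by rewrite uT memvf.
  by rewrite orbit_mapE -[h](vsprojK hs) -fE memv_img ?memvf.
have TE h : h \in annv s -> T (rho h u) = rho h v.
  move=> hs; rewrite !comp_lfunE lfunE orbit_mapE /=; set y := f^-1%VF _.
  apply/eqP; rewrite -subr_eq0 -opp_lfunE -add_lfunE -linearB; apply/eqP/rho0.
    by rewrite memvB ?subvsP.
  rewrite linearB add_lfunE opp_lfunE -fE limg_lfunVK ?limgf //.
  by rewrite subrr.
have [a | c Tc] := abs_simple_End (T := T) Vsimple.
  apply/lfunP => x; rewrite [LHS]comp_lfunE [RHS]comp_lfunE.
  have /memv_imgP[h hs ->] : x \in (orbit_map u @: annv s)%VS by rewrite uT memvf.
  have rhoM w : rho a (rho h w) = rho (a * h) w by rewrite Vmod.2 comp_lfunE.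
  rewrite orbit_mapE TE // !rhoM TE //.
  apply/annvP => w ws; rewrite Vmod.2 comp_lfunE (annvP _ _ hs _ ws).
  by rewrite linear0.
(* Since hv = c hu on [annv s], the vector v - cu is killed by [annv s], and the induction
   hypothesis applies to it. *)
rewrite -[v](subrK (c *: u)) addrC span_cons memv_add ?memvZ ?memv_line //.
apply: IHs; apply/eqP; rewrite -subv0; apply/subvP => _ /memv_imgP[h hs ->].
rewrite memv0 orbit_mapE linearB linearZ /= -TE // Tc scale_lfunE id_lfunE.
by rewrite subrr.
Qed.

(** A basis vector is outside the span of the others, so by density some h kills the others and
    sends it to any prescribed vector. Summing such elements over the basis realises every [f]. *)
Lemma abs_simple_surj (f : 'End(V)) : exists h, rho h = f.
Proof.
suff hP (i : 'I_(\dim {:V})) : exists h, forall j : 'I_(\dim {:V}),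
    rho h e`_j = f e`_i *+ (j == i).
  have [F FP] := fin_all_exists hP; exists (\sum_i F i); apply/lfunP => x.
  rewrite (coord_vbasis (memvf x)) !linear_sum; apply: eq_bigr => j _.
  rewrite !linearZ /=; congr (_ *: _); rewrite sum_lfunE.
  rewrite (bigD1 j) //= FP eqxx big1 ?addr0 // => i ij.
  by rewrite FP eq_sym (negPf ij).
pose s := [seq e`_j | j : 'I_(\dim {:V}) <- enum (predC1 i)].
have [/annv_span|T] := orbit_annv s e`_i.
  (* The projection onto the line of e_i along the other basis vectors vanishes on [s] but not at
     e_i. *)
  pose P := hommx e e (delta_mx i i).
  have PE (j : 'I_(\dim {:V})) : P e`_j = e`_i *+ (j == i).
    rewrite hommxE ?rVofE // mul_delta_mx_cond.
    by rewrite linearMn /= vecof_delta.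
  have /span_subvP/subvP sP : {subset s <= lker P}.
    move=> _ /mapP[j + ->]; rewrite mem_enum !inE memv_ker PE => /negPf->.
    by rewrite mulr0n.
  move/sP; rewrite memv_ker PE eqxx; suff /negPf-> : e`_i != 0 by [].
  by rewrite (free_not0 (basis_free eB)) // mem_nth ?size_tuple.
have /memv_imgP[h hs fE] : f e`_i \in (orbit_map e`_i @: annv s)%VS.
  by rewrite T memvf.
exists h => j; have [-> | ji] := eqVneq j i; first by rewrite fE orbit_mapE.
by rewrite (annvP _ _ hs) ?mulr0n //; apply: map_f; rewrite mem_enum.
Qed.

End Density.

(** * Pure tensors, their matrices, and traces *)

Section Tensor.
Variable k : fieldType.
Implicit Types U V W : vectType k.

Lemma tprod_mx U V (u : U) (v : V) :
  tprod u v = (rVof (vbasis {:U}) u)^T *m rVof (vbasis {:V}) v.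
Proof. by apply/matrixP => i j; rewrite !mxE big_ord1 !mxE. Qed.

Lemma tprod_linear_l U V (v : V) : linear (fun u : U => tprod u v).
Proof.
by move=> c x y; rewrite !tprod_mx !linearP mulmxDl -scalemxAl.
Qed.

Lemma tprod_linear_r U V (u : U) : linear (fun v : V => tprod u v).
Proof.
by move=> c x y; rewrite !tprod_mx !linearP.
Qed.

(** Pure tensors span, because each elementary matrix is the pure tensor of two basis vectors.
    Linear identities can thus be checked on pure tensors. *)
Lemma tensor_ind U V (P : tensor U V -> Prop) :
    (forall c s t, P s -> P t -> P (c *: s + t)) ->
    (forall u v, P (tprod u v)) ->
  forall t, P t.
Proof.
move=> Plin Ptprod t; have P0 : P 0.
  by rewrite -(subrr (tprod 0 0)) addrC -scaleN1r; apply: Plin.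
have PD s s' : P s -> P s' -> P (s + s').
  by rewrite -{2}[s]scale1r; apply: Plin.
rewrite (matrix_sum_delta t); apply: big_ind => // i _; apply: big_ind => // j _.
rewrite -[_ *: _]addr0; apply: Plin => //.
suff -> : delta_mx i j = tprod (vbasis {:U})`_i (vbasis {:V})`_j by [].
by rewrite tprod_mx !rVofE ?vbasisP // trmx_delta mul_delta_mx.
Qed.

Lemma tmapE U U' V V' (f : 'Hom(U, U')) (g : 'Hom(V, V')) u v :
  tmap f g (tprod u v) = tprod (f u) (g v).
Proof.
apply: tlift_tprod => [y|x] c s t; rewrite linearP.
  exact: (tprod_linear_l (g y)).
exact: (tprod_linear_r (f x)).
Qed.

(** Vectors are rows and u (x) v is the matrix u^T v, which is why the map on the left factor enters
    through its transpose. *)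
Lemma tmap_mx U U' V V' (f : 'Hom(U, U')) (g : 'Hom(V, V')) t :
  tmap f g t = (mxof (vbasis {:U}) (vbasis {:U'}) f)^T *m t
                 *m mxof (vbasis {:V}) (vbasis {:V'}) g.
Proof.
elim/tensor_ind: t => [c s t IHs IHt|u v].
  by rewrite linearP /= IHs IHt mulmxDr mulmxDl -scalemxAr -scalemxAl.
rewrite tmapE !tprod_mx (rVof_app _ (vbasisP {:U})) (rVof_app _ (vbasisP {:V})).
by rewrite trmx_mul !mulmxA.
Qed.

(** Serves the nested [tlift] in [tassoc], whose inner bilinear map depends on the third factor. *)
Lemma tlift_linear_fun U V W (b b1 b2 : U -> V -> W) c t :
    (forall u v, b u v = c *: b1 u v + b2 u v) ->
  tlift b t = c *: tlift b1 t + tlift b2 t.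
Proof.
move=> bE; rewrite !lfunE /= /tlift_fun scaler_sumr -big_split.
apply: eq_bigr => i _; rewrite scaler_sumr -big_split; apply: eq_bigr => j _.
by rewrite bE scalerDr !scalerA [c * _]mulrC.
Qed.

Lemma tassocE U V W (u : U) (v : V) (w : W) :
  tassoc U V W (tprod (tprod u v) w) = tprod u (tprod v w).
Proof.
rewrite tlift_tprod => [|w' c s t|t c x y].
- rewrite tlift_tprod // => [v'|u'] c x y; first exact: tprod_linear_l.
  by rewrite [X in tprod u' X]tprod_linear_l; exact: tprod_linear_r.
- exact: linearP.
apply: tlift_linear_fun => u' v'.
by rewrite [X in tprod u' X]tprod_linear_r; exact: tprod_linear_r.
Qed.

Lemma tmullE (A : falgType k) (a b : A) : tmull A (tprod a b) = a * b.
Proof.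
apply: tlift_tprod => [v c x y|u c x y]; first by rewrite mulrDl scalerAl.
by rewrite mulrDr scalerAr.
Qed.

(* The E i only span V; c gives a decomposition along them, not coordinates. *)
Lemma lftrace_frame V (I : finType) (E : I -> V) (c : I -> V -> k) (f : 'End(V)) :
    (forall i, scalar (c i)) -> (forall v, v = \sum_i c i v *: E i) ->
  lftrace f = \sum_i c i (f (E i)).
Proof.
move=> clin vE; pose b := vbasis {:V}.
pose C i : {scalar V} := HB.pack (c i) (GRing.isLinear.Build k V k _ (c i) (clin i)).
(* The double sum arises from the left side by decomposing each basis vector along the [E i], and
   from the right side by expanding each f(E i) in the basis. *)
transitivity (\sum_(l < \dim {:V}) \sum_i c i b`_l * coord b l (f (E i))).
  apply: eq_bigr => l _; rewrite !mxE /= vecof_delta {1}[b`_l]vE.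
  rewrite !linear_sum; apply: eq_bigr => i _.
  by rewrite !linearZ.
rewrite exchange_big; apply: eq_bigr => i _ /=.
rewrite [in RHS](coord_vbasis (memvf (f (E i)))) -[c i]/(C i : _ -> _) linear_sum.
by apply: eq_bigr => l _; rewrite linearZ mulrC.
Qed.

Lemma lftrace_scale V c : lftrace (c *: \1 : 'End(V))%VF = c *+ \dim {:V}.
Proof.
rewrite /lftrace linearZ /= mxof1 ?(basis_free (vbasisP _)) //.
by rewrite mxtraceZ mxtrace1 mulr_natr.
Qed.

End Tensor.

(** * Invariants of V (x) V as matrices *)

Section Invariants.
Variables (k : fieldType) (H : hopfType k) (V : vectType k).
Variables (rho : 'Hom(H, 'End(V))).
Hypothesis Vmod : is_hmod rho.
Let e := vbasis {:V}.
Let eB : basis_of fullv e := vbasisP {:V}.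

Definition rho_mx (h : H) : 'M_(\dim {:V}) := mxof e e (rho h).

Lemma rho_mx_linear : linear rho_mx.
Proof. by move=> c x y; rewrite /rho_mx !linearP. Qed.
HB.instance Definition _ := GRing.isLinear.Build k _ _ _ rho_mx rho_mx_linear.

Lemma rho_mx1 : rho_mx 1 = 1%:M.
Proof. by rewrite /rho_mx Vmod.1 mxof1 ?(basis_free eB). Qed.

(** The order is reversed because matrices act on rows from the right. *)
Lemma rho_mxM a b : rho_mx (a * b) = rho_mx b *m rho_mx a.
Proof. by rewrite /rho_mx Vmod.2 (mxof_comp e e eB). Qed.

Lemma tensor_actE a b w :
  tensor_act rho (tprod a b) w = (rho_mx a)^T *m w *m rho_mx b.
Proof.
rewrite /tensor_act tlift_tprod ?tmap_mx // => [b'|a'] c x y; apply/lfunP => t.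
  rewrite add_lfunE scale_lfunE !tmap_mx !linearP /=.
  by rewrite !mulmxDl -!scalemxAl.
by rewrite add_lfunE scale_lfunE !tmap_mx !linearP.
Qed.

(** In Sweedler notation, with A = [rho_mx rho], the forward direction computes the sum of
    A(S(h_1))^T A(h_2)^T w A(h_3) in two ways. The converse rewrites the sum of A(h_1)^T w A(h_2) as
    A(h_1 S(h_2))^T w. *)
Lemma inv_space_mxP w :
  w \in inv_space rho <->
  forall h, (rho_mx (antipode h))^T *m w = w *m rho_mx h.
Proof.
rewrite inv_spaceP; split=> wE h.
  pose F : 'Hom(tensor H (tensor H H), 'M[k]_(\dim {:V})) :=
    tlift (fun a t => (rho_mx (antipode a))^T *m tensor_act rho t w).
  have FE a t : F (tprod a t) = (rho_mx (antipode a))^T *m tensor_act rho t w.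
    apply: tlift_tprod => [t' c x y|a' c x y].
      by rewrite /= !linearP /= mulmxDl -scalemxAl.
    by rewrite /tensor_act linearP add_lfunE scale_lfunE !linearP.
  (* Invariance collapses h_2 (x) h_3 to a counit, leaving A(S(h))^T w. *)
  have Fr t : F (tmap \1 comul t) =
      (rho_mx (antipode (tlift (fun a b : H => (counit b : k) *: a) t)))^T *m w.
    elim/tensor_ind: t => [c s t IHs IHt|a b].
      by rewrite !linearP /= IHs IHt mulmxDl -scalemxAl.
    rewrite tmapE id_lfunE FE wE tlift_tprod => [|b' c x y|a' c x y].
    - by rewrite !linearZ /= -scalemxAl.
    - by rewrite scalerDr !scalerA mulrC.
    by rewrite linearP scalerDl scalerA.
  (* After reassociation, S(h_1) h_2 collapses by the antipode axiom, leaving w A(h). *)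
  have Fl t : F (tassoc H H H (tmap comul \1 t)) =
      w *m rho_mx (tlift (fun a b : H => (counit a : k) *: b) t).
    elim/tensor_ind: t => [c s t IHs IHt|a b].
      by rewrite !linearP /= IHs IHt.
    have Fs s : F (tassoc H H H (tprod s b)) =
        (rho_mx (tmull H (tmap antipode \1 s)))^T *m w *m rho_mx b.
      elim/tensor_ind: s => [c s t IHs IHt|x y].
        by rewrite tprod_linear_l !linearP /= IHs IHt !mulmxDl -!scalemxAl.
      rewrite tassocE FE tensor_actE tmapE tmullE id_lfunE rho_mxM trmx_mul.
      by rewrite !mulmxA.
    rewrite tmapE id_lfunE Fs antipodel linearZ /= rho_mx1.
    rewrite tlift_tprod => [|b' c x y|a' c x y].
    - by rewrite !linearZ /= trmx1 -!scalemxAl mul1mx.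
    - by rewrite linearP scalerDl scalerA.
    by rewrite scalerDr !scalerA mulrC.
  by have := Fr (comul h); rewrite -comulA Fl counitl counitr.
have actE t : tensor_act rho t w = (rho_mx (tmull H (tmap \1 antipode t)))^T *m w.
  elim/tensor_ind: t => [c s t IHs IHt|a b].
    by rewrite /tensor_act !linearP /= add_lfunE scale_lfunE IHs IHt mulmxDl -scalemxAl.
  rewrite tensor_actE -mulmxA -wE tmapE tmullE id_lfunE rho_mxM trmx_mul.
  by rewrite mulmxA.
by rewrite actE antipoder linearZ /= rho_mx1 linearZ /= trmx1 -scalemxAl mul1mx.
Qed.

End Invariants.

(** * Invariants, self-duality and the indicator of an absolutely simple module *)

Section AbsSimple.
Variables (k : fieldType) (H : hopfType k) (V : vectType k).
Variables (rho : 'Hom(H, 'End(V))).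
Hypotheses (Vmod : is_hmod rho) (Vsimple : abs_simple rho).
Let e := vbasis {:V}.
Let eB : basis_of fullv e := vbasisP {:V}.

Lemma rho_mx_surj (B : 'M_(\dim {:V})) : exists h, rho_mx rho h = B.
Proof.
have [h hE] := abs_simple_surj Vmod Vsimple (hommx e e B).
by exists h; rewrite /rho_mx hE hommxK.
Qed.

(** If w x^T = 0 with x nonzero, then w A(h) x^T = A(S(h))^T w x^T = 0 for all h. By density w B x^T
    = 0 for every matrix B, which forces w = 0. *)
Lemma inv_space_unitmx (w : tensor V V) :
  w \in inv_space rho -> w != 0 -> w \in unitmx.
Proof.
move=> /(inv_space_mxP Vmod) wE; apply: contraNT => w_sing; apply/eqP.
have [x xw x_neq0] : exists2 x : 'rV_(\dim {:V}), x *m w^T = 0 & x != 0.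
  apply: contrapT => nx; move/negP: w_sing; apply.
  rewrite -unitmx_tr -row_free_unit; apply: inj_row_free => x xw.
  by apply: contrapT => /eqP x_neq0; apply: nx; exists x.
have wBx B : w *m B *m x^T = 0.
  have [h <-] := rho_mx_surj B; rewrite -wE -mulmxA.
  by rewrite -[w]trmxK -trmx_mul xw trmx0 mulmx0.
have /rowV0Pn[_ /sub_rVP[c ->] cx] : x != 0 by [].
have [j xj] : exists j, x 0 j != 0.
  apply: contrapT => nx; move/eqP: x_neq0; apply; apply/rowP => j.
  by rewrite mxE; apply: contrapT => xj; apply: nx; exists j; apply/eqP.
(* For B the elementary matrix at (i, j), entry a of w B x^T is w_ai x_j, and x_j is nonzero. *)
apply/matrixP => a i; have := congr1 (fun M : 'cV_ _ => M a 0) (wBx (delta_mx i j)).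
rewrite -mulmxA !mxE (bigD1 i) //= big1 => [|l li]; last first.
  rewrite !mxE big1 ?mulr0 // => l' _.
  by rewrite !mxE (negPf li) mul0r.
rewrite !mxE (bigD1 j) //= big1 => [|l lj]; last first.
  by rewrite !mxE (negPf lj) andbF mul0r.
by rewrite !mxE !eqxx mul1r !addr0 => /eqP; rewrite mulf_eq0 (negPf xj) orbF => /eqP.
Qed.

(** The matrix w^-1 w' commutes with every A(h), so it is scalar by Schur's lemma. *)
Lemma inv_space_line (w w' : tensor V V) :
  w \in inv_space rho -> w != 0 -> w' \in inv_space rho -> exists c, w' = c *: w.
Proof.
move=> w_inv w_neq0 /(inv_space_mxP Vmod) w'E.
have w_unit := inv_space_unitmx w_inv w_neq0.
have wE := (inv_space_mxP Vmod w).1 w_inv.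
have [|c cE] := abs_simple_End (T := hommx e e (invmx w *m w')) Vsimple.
  move=> h; apply: (can_inj (mxofK eB eB)); rewrite !(mxof_comp e e eB) !hommxK //.
  rewrite -/(rho_mx rho h) -[RHS]mulmxA -w'E.
  by rewrite -[X in X *m _](mulKmx w_unit) -wE -!mulmxA mulKVmx.
exists c; rewrite -[w'](mulKVmx w_unit) -[invmx w *m w'](hommxK eB eB) cE.
by rewrite linearZ /= mxof1 ?(basis_free eB) // -scalemxAr mulmx1.
Qed.

Lemma bilinear_mxE (G : 'M_(\dim {:V})) (T : 'Hom(V, 'Hom(V, k^o))) :
    (forall i j : 'I_(\dim {:V}), T e`_i e`_j = G i j) ->
  forall v w, T v w = (rVof e v *m G *m (rVof e w)^T) 0 0.
Proof.
move=> TG v w; rewrite {1}(coord_vbasis (memvf v)) linear_sum sum_lfunE.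
rewrite -mulmxA mxE; apply: eq_bigr => i _; rewrite linearZ scale_lfunE !mxE.
congr (_ * _); rewrite {1}(coord_vbasis (memvf w)) linear_sum.
by apply: eq_bigr => j _; rewrite linearZ !mxE mulrC -TG.
Qed.

(** The Gram matrix G of an isomorphism from V to its dual satisfies A(h) G = G A(S(h))^T, which
    says that G^-1 is invariant. Conversely, the inverse of a nonzero invariant is the Gram matrix
    of such an isomorphism. *)
Lemma self_dualP :
  self_dual rho <-> exists2 w, w \in inv_space rho & w != 0.
Proof.
have d_neq0 : (1%:M : 'M[k]_(\dim {:V})) != 0.
  apply/eqP => /matrixP/(_ (Ordinal Vsimple.1.1) (Ordinal Vsimple.1.1)).
  by rewrite !mxE eqxx => /eqP; rewrite oner_eq0.
split=> [[T [T' TK _] Trho]|[w w_inv w_neq0]].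
  pose G : 'M[k]_(\dim {:V}) := \matrix_(i, j) (T e`_i e`_j : k).
  have TE : forall v w, T v w = (rVof e v *m G *m (rVof e w)^T) 0 0.
    by apply: bilinear_mxE => i j; rewrite mxE.
  have GE h : rho_mx rho h *m G = G *m (rho_mx rho (antipode h))^T.
    apply/matrixP => i j; have := Trho h e`_i => /lfunP/(_ e`_j).
    rewrite dual_actE !TE !(rVof_app _ eB) !rVofE // trmx_mul trmx_delta.
    by rewrite -!mulmxA -!rowE !mulmxA -!colE !mxE.
  have G_unit : G \in unitmx.
    rewrite -row_free_unit; apply: inj_row_free => x xG.
    rewrite -[x](vecofK eB) -[vecof e x]TK.
    suff -> : T (vecof e x) = 0.
      by rewrite -(linear0 T) TK linear0.
    by apply/lfunP => w; rewrite TE vecofK // xG mul0mx mxE zero_lfunE.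
  exists (invmx G); last first.
    apply: contraNneq d_neq0 => G0; rewrite -(mulmxV G_unit) G0.
    by rewrite mulmx0.
  apply/(inv_space_mxP Vmod) => h.
  by rewrite -[LHS](mulKmx G_unit) [G *m _]mulmxA -GE mulmxK.
have w_unit := inv_space_unitmx w_inv w_neq0.
have wE := (inv_space_mxP Vmod w).1 w_inv.
pose beta (v u : V) : k^o := (rVof e v *m invmx w *m (rVof e u)^T) 0 0.
have beta_lin v : linear (beta v).
  by move=> c x y; rewrite /beta !linearP !mxE.
pose Beta v : {linear V -> k^o} := HB.pack (beta v)
  (GRing.isLinear.Build k _ _ _ _ (beta_lin v)).
have BetaE v u : linfun (Beta v) u = beta v u by rewrite lfunE.
have linBeta : linear (fun v => linfun (Beta v)).
  move=> c x y; apply/lfunP => u; rewrite add_lfunE scale_lfunE !BetaE /beta.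
  by rewrite linearP !mulmxDl -!scalemxAl !mxE.
pose LBeta : {linear V -> 'Hom(V, k^o)} := HB.pack (fun v => linfun (Beta v))
  (GRing.isLinear.Build k _ _ _ _ linBeta).
have TE v u : linfun LBeta v u = beta v u by rewrite lfunE /= BetaE.
exists (linfun LBeta); last first.
  move=> h v; apply/lfunP => u; rewrite dual_actE !TE /beta !(rVof_app _ eB).
  congr (_ _ 0 0); rewrite trmx_mul -!mulmxA; congr (_ *m _).
  rewrite -/(rho_mx rho h) -/(rho_mx rho (antipode h)) !mulmxA.
  congr (_ *m _); rewrite -[LHS](mulKmx w_unit) [w *m _]mulmxA -wE.
  by rewrite mulmxK.
(* The inverse map multiplies the row of values of f on the basis by w, undoing the Gram matrix
   w^-1. *)
exists (fun f : 'Hom(V, k^o) => vecof e (\row_j (f e`_j : k) *m w)) => [v|f].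
  apply: (can_inj (rVofK eB)); rewrite vecofK // -[RHS](mulmxKV w_unit).
  congr (_ *m _); apply/rowP => j; rewrite mxE TE /beta rVofE // trmx_delta.
  by rewrite -colE mxE.
apply/lfunP => u; rewrite TE /beta vecofK // mulmxK // mxE.
rewrite [in RHS](coord_vbasis (memvf u)) linear_sum; apply: eq_bigr => j _.
by rewrite linearZ !mxE mulrC.
Qed.

Lemma E2_mx g w : E2 g rho w = w^T *m rho_mx rho g^-1.
Proof.
elim/tensor_ind: w => [c s t IHs IHt|u v].
  by rewrite /E2 !linearP /= -/(E2 g rho) IHs IHt mulmxDl -scalemxAl.
rewrite /E2 tlift_tprod => [|y c a b|x c a b]; last 1 first.
- exact: tprod_linear_l.
- by rewrite !tprod_mx trmx_mul trmxK (rVof_app _ eB) mulmxA.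
by rewrite linearP; apply: tprod_linear_r.
Qed.

(** Transposing invariance gives A(S(h))^T w^T = w^T A(S^2(h)), and g^-1 S^2(h) = h g^-1 moves
    A(g^-1) past A(h). *)
Lemma E2_inv_space g : pivotal g -> (E2 g rho @: inv_space rho <= inv_space rho)%VS.
Proof.
case=> g_gl S2; have g_unit := grouplike_unit g_gl.
apply/subvP => _ /memv_imgP[w /(inv_space_mxP Vmod) wE ->].
apply/(inv_space_mxP Vmod) => h; rewrite E2_mx.
have wTE x : w^T *m rho_mx rho (antipode x) = (rho_mx rho x)^T *m w^T.
  by rewrite -trmx_mul -wE trmx_mul trmxK.
by rewrite mulmxA -wTE S2 -!mulmxA -!rho_mxM // -[g * h * _]mulrA mulKr.
Qed.

(** As S(g) = g^-1, invariance at g gives A(g^-1)^T = w A(g) w^-1, and the traces agree. *)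
Lemma qdiml_qdimr g w : pivotal g -> w \in inv_space rho -> w != 0 ->
  qdiml g rho = qdimr g rho.
Proof.
case=> g_gl _ w_inv w_neq0; have w_unit := inv_space_unitmx w_inv w_neq0.
have wE := (inv_space_mxP Vmod w).1 w_inv g.
have Sg : antipode g = g^-1.
  have g_unit := grouplike_unit g_gl; apply: (mulrI g_unit); rewrite divrr //.
  have := antipoder g; rewrite g_gl.1 tmapE tmullE id_lfunE g_gl.2.
  by rewrite scale1r.
rewrite /qdiml /qdimr /hmod_char /lftrace -/(rho_mx rho g^-1) -/(rho_mx rho g).
rewrite -Sg -mxtrace_tr -[X in \tr X](mulmxK w_unit) wE mxtrace_mulC.
by rewrite mulKmx.
Qed.

Lemma gamma_mx w : w \in inv_space rho -> w != 0 ->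
  gamma rho = \tr (w^T *m invmx w).
Proof.
move=> w_inv w_neq0; have w_unit := inv_space_unitmx w_inv w_neq0.
have wE := (inv_space_mxP Vmod w).1 w_inv.
have sdV : self_dual rho by apply/self_dualP; exists w.
rewrite /gamma asboolT //; pose d := \dim {:V}.
(* Lifts of the matrix units to [H]; their classes serve as a frame of H / ann V, with matrix
   entries as coefficients. *)
have [h hE] : exists h : 'I_d * 'I_d -> H,
    forall ij, rho_mx rho (h ij) = delta_mx ij.1 ij.2.
  apply: (fin_all_exists (P := fun ij x => rho_mx rho x = delta_mx ij.1 ij.2)).
  by move=> ij; apply: rho_mx_surj.
(* The representative chosen by the quotient differs from x by an element of ann V, so both have the
   same matrix. *)
have rho_proj x : rho_mx rho (vsval (quot_proj (lker rho) x)) = rho_mx rho x.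
  have: vsval (quot_proj (lker rho) x) - x \in lker (quot_proj (lker rho)).
    by rewrite memv_ker linearB /= quot_projK subrr.
  rewrite quot_proj_ker memv_ker -(mxof_eq0 eB eB) -/(rho_mx rho _) linearB /=.
  by rewrite subr_eq0 => /eqP.
pose c (ij : 'I_d * 'I_d) (x : quotv (lker rho)) : k :=
  rho_mx rho (vsval x) ij.1 ij.2.
rewrite (lftrace_frame (E := fun ij => quot_proj (lker rho) (h ij)) (c := c)).
- transitivity (\sum_(i < d) \sum_(j < d) w^T i j * invmx w j i).
    rewrite pair_big; apply: eq_bigr => -[i j] _ /=.
    rewrite quot_lfunE ?antipode_ann // /c rho_proj /=.
    (* S_V sends the matrix unit E_ij to (w E_ij w^-1)^T, whose (i, j) entry is w_ji times the (j,
       i) entry of w^-1. *)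
    transitivity ((w *m delta_mx i j *m invmx w) j i).
      by rewrite -[delta_mx i j](hE (i, j)) -wE mulmxK // [RHS]mxE.
    rewrite -(mul_delta_mx (0 : 'I_1)) !mulmxA -colE -mulmxA -rowE.
    by rewrite !mxE big_ord1 !mxE.
  by apply: eq_bigr => i _; rewrite mxE.
- by move=> ij a x y; rewrite /c !linearP !mxE.
move=> x; rewrite -[LHS]quot_projK; under eq_bigr do rewrite -linearZ.
rewrite -linear_sum /=; apply/eqP; rewrite -subr_eq0 -linearB -memv_ker /=.
rewrite quot_proj_ker memv_ker -(mxof_eq0 eB eB) -/(rho_mx rho _) linearB /=.
rewrite subr_eq0 linear_sum; apply/eqP.
rewrite [LHS]matrix_sum_delta pair_big; apply: eq_bigr => ij _.
by rewrite linearZ /= hE.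
Qed.

(** The invariants form the line spanned by w and are stable under [E2 g rho], so it acts there by a
    scalar equal to its trace. *)
Lemma nu2_mx g w : pivotal g -> w \in inv_space rho -> w != 0 ->
  E2 g rho w = nu2 g rho *: w.
Proof.
move=> g_piv w_inv w_neq0.
have EU := E2_inv_space g_piv.
have line x : x \in inv_space rho -> exists c, x = c *: w.
  exact: inv_space_line.
have [c cE] := line _ (subvP EU _ (memv_img (E2 g rho) w_inv)).
rewrite cE; congr (_ *: _); rewrite /nu2.
have -> : restr_lfun (inv_space rho) (E2 g rho) = (c *: \1)%VF.
  apply/lfunP => u; apply: val_inj; rewrite /= restr_lfunE //.
  have [a aE] := line _ (subvsP u).
  by rewrite scale_lfunE id_lfunE linearZ /= aE linearZ /= cE !scalerA mulrC.
rewrite lftrace_scale; suff -> : inv_space rho = <[w]>%VS.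
  by rewrite dimvf /dim /= dim_vline w_neq0.
apply/eqP; rewrite eqEsubv -memvE w_inv andbT; apply/subvP => x /line[a ->].
by rewrite memvZ ?memv_line.
Qed.

Lemma gamma_nu2 g : pivotal g ->
  gamma rho = nu2 g rho * qdimr g rho /\
  nu2 g rho * qdiml g rho = nu2 g rho * qdimr g rho.
Proof.
move=> g_piv; have [[w w_inv w_neq0]|w0] :=
    EM (exists2 w, w \in inv_space rho & w != 0); last first.
  (* Without nonzero invariants V is not self-dual, so gamma is 0 by convention, and nu_2 is a trace
     on the zero space. *)
  have inv0 w : w \in inv_space rho -> w = 0.
    by move=> w_inv; apply: contrapT => /eqP w_neq0; apply: w0; exists w.
  have -> : gamma rho = 0 by rewrite /gamma asboolF // self_dualP.
  suff -> : nu2 g rho = 0 by rewrite !mul0r.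
  rewrite /nu2; set f := restr_lfun _ _; have -> : f = (0 *: \1)%VF.
    apply/lfunP => u; apply: val_inj; rewrite scale0r zero_lfunE /=.
    exact: inv0 (subvsP (f u)).
  by rewrite lftrace_scale mul0rn.
rewrite (qdiml_qdimr g_piv w_inv w_neq0); split=> //.
have w_unit := inv_space_unitmx w_inv w_neq0.
have g_unit := grouplike_unit g_piv.1.
rewrite (gamma_mx w_inv w_neq0).
(* Obtained by multiplying w^T A(g^-1) = nu_2 w on the right by A(g). *)
have -> : w^T = nu2 g rho *: (w *m rho_mx rho g).
  rewrite scalemxAl -(nu2_mx g_piv w_inv w_neq0) E2_mx -mulmxA -rho_mxM //.
  by rewrite divrr // rho_mx1 // mulmx1.
by rewrite -scalemxAl mxtraceZ mxtrace_mulC mulKmx.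
Qed.

End AbsSimple.

Theorem proposition4p5 (k : fieldType) (H : hopfType k)
    (V : vectType k) (rho : 'Hom(H, 'End(V)))
    (Vmod : is_hmod rho) (Vsimple : abs_simple rho) :
  (forall g : H, pivotal g ->
     gamma rho = nu2 g rho * qdiml g rho /\
     nu2 g rho * qdiml g rho = nu2 g rho * qdimr g rho) /\
  (forall g g' : H, pivotal g -> pivotal g' ->
     nu2 g rho * qdiml g rho = nu2 g' rho * qdiml g' rho).
Proof.
have gammaE g : pivotal g -> gamma rho = nu2 g rho * qdiml g rho.
  by move=> /(gamma_nu2 Vmod Vsimple)[-> ->].
(* For independence of the pivotal element, both products equal gamma, whose definition does not
   involve g. *)
split=> [g g_piv | g g' g_piv g'_piv]; last by rewrite -!gammaE.
by split; [exact: gammaE | have [] := gamma_nu2 Vmod Vsimple g_piv].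
Qed.
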